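(* Let $(\alpha,\beta)$ be a pair of real-valued random variables with $\mathbb{P}(\alpha\neq0)=1$ and $\mathbb{P}(|\alpha|\neq1)>0$, and suppose that $\alpha,\beta$ are in resonance, i.e. there is a non-random constant $c\in\mathbb{R}$ such that $\alpha(c-\beta)=c$ almost surely. Then any bounded continuous function $y:\mathbb{R}\to\mathbb{R}$ satisfying $$y(x)=\mathbb{E}\{y(\alpha(x-\beta))\}\qquad\text{for all }x\in\mathbb{R}$$ is constant.
   Context: $\mathbb{E}$ denotes expectation with respect to the joint distribution of $(\alpha,\beta)$, an arbitrary probability measure on $\mathbb{R}^2$ subject to the stated hypotheses. No assumption is made on $\mathbb{E}\{\ln|\alpha|\}$ or on its existence. *)

(* Defs.v *)
From HB Require Import structures.
From mathcomp Require Import all_boot all_order all_algebra.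
From mathcomp Require Import all_classical all_reals all_analysis.
Set Implicit Arguments.
Unset Strict Implicit.
Unset Printing Implicit Defensive.
Import Order.TTheory GRing.Theory Num.Theory.
Import numFieldNormedType.Exports.
Local Open Scope classical_set_scope.
Local Open Scope ring_scope.

Definition resonance (d : measure_display) (T : measurableType d)
    (R : realType) (P : probability T R) (alpha beta : {RV P >-> R}) : Prop :=
  exists c : R, {ae P, forall w, alpha w * (c - beta w) = c}.

(* Main.v *)
(* Resonance makes [z u = y (c + u)] satisfy [z u = E (z (alpha u))].  Put
   [g u = E ((z (alpha u) - z u) ^ 2) = E (z (alpha u) ^ 2) - z u ^ 2].  Since
   dilations commute, Jensen's inequality gives [g u <= E (g (alpha u))], so
   [z ^ 2] grows in mean by at least [n * g u] along [n] steps of the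
   multiplicative random walk started at [u]; as [z] is bounded, [g = 0].  By
   continuity, almost every value [a] of [alpha] then satisfies
   [z (a u) = z u] for all [u] simultaneously; one such [a] has
   [a != 0, |a| != 1], and iterating the dilation by [a] or by its inverse
   yields [z u = z 0].  *)
Require Import Defs.
From HB Require Import structures.
From mathcomp Require Import all_boot all_order all_algebra.
From mathcomp Require Import all_classical all_reals all_analysis.
From mathcomp Require Import measurable_realfun ring.
Set Implicit Arguments.
Unset Strict Implicit.
Unset Printing Implicit Defensive.
Import Order.TTheory GRing.Theory Num.Theory.
Import numFieldNormedType.Exports.
Local Open Scope classical_set_scope.
Local Open Scope ring_scope.

(** * Continuous functions on the line *)

(** The set where [f - g] is nonzero is open, so it would contain a rational if it had a point. This
    later replaces uncountably many almost sure equalities by countably many. *)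
Lemma ratr_eq_continuous (R : realType) (f g : R -> R) :
  continuous f -> continuous g -> (forall q : rat, f (ratr q) = g (ratr q)) ->
  f =1 g.
Proof.
move=> fcont gcont fg x; apply/eqP/negPn/negP => fgx.
have opn : open [set t | f t - g t != 0].
  apply: (@open_comp _ _ (fun t => f t - g t) [set r | r != 0]); last first.
    exact: open_neq.
  by move=> t _; apply: cvgB; [exact: fcont|exact: gcont].
have [] := @dense_rat R [set t | f t - g t != 0] _ opn.
  by exists x; rewrite /= subr_eq0.
by move=> _ [/= /[swap] -[q _ <-]]; rewrite fg subrr eqxx.
Qed.

Lemma dilation_invariant_cst (R : realType) (z : R -> R) (a : R) :
  continuous z -> a != 0 -> `|a| != 1 -> (forall u, z (a * u) = z u) ->
  forall u, z u = z 0.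
Proof.
move=> zcont a0 a1 zE.
(* For a contraction [b], the sequence [z (b ^+ n * u)] is constantly [z u], yet tends to [z 0] by
   continuity. *)
have contract b : `|b| < 1 -> (forall u, z (b * u) = z u) ->
    forall u, z u = z 0.
  move=> b1 bE u.
  have zX n : z (b ^+ n * u) = z u.
    by elim: n => [|n IH]; rewrite ?expr0 ?mul1r// exprS -mulrA bE.
  have bX0 : b ^+ n * u @[n --> \oo] --> (0 : R).
    by rewrite -[X in _ --> X](mul0r u); apply: cvgMr_tmp; exact: cvg_expr.
  have zX0 : z (b ^+ n * u) @[n --> \oo] --> z 0.
    exact: cvg_comp _ _ bX0 (zcont 0).
  by apply: (cvg_unique _ _ zX0) => //; apply: cvg_near_cst; exact: nearW.
case: (ltgtP `|a| 1) a1 => // [a1 _|a1 _]; first exact: (contract a).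
apply: (contract a^-1) => [|u]; first by rewrite normfV invf_lt1// normr_gt0.
by rewrite -zE mulrA divff// mul1r.
Qed.

(** * Bounded harmonic functions of the multiplicative walk *)

Section harmonic.
Variables (d : measure_display) (T : measurableType d) (R : realType).
Variable P : probability T R.

Lemma bounded_measurable_integrable (f : T -> R) (M : R) :
  measurable_fun setT f -> (forall w, `|f w| <= M) ->
  P.-integrable setT (EFin \o f).
Proof.
move=> mf fM; apply: measurable_bounded_integrable => //.
- by rewrite [X in (X < _)%E](probability_setT P) ltry.
- exists M; split=> [|r Mr w _]; first exact: num_real.
  exact: le_trans (fM w) (ltW Mr).
Qed.

(** Variance identity, from integrating [f ^ 2 = (f - m) ^ 2 + 2 m f - m ^ 2] termwise. It gives
    both the mean growth of [z ^ 2] in one step and Jensen's inequality for the square. *)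
Lemma integral_sqr_mean (f : T -> R) (M m : R) :
  measurable_fun setT f -> (forall w, `|f w| <= M) ->
  (\int[P]_w (f w)%:E = m%:E)%E ->
  (\int[P]_w ((f w) ^+ 2)%:E =
     (m ^+ 2)%:E + \int[P]_w ((f w - m) ^+ 2)%:E)%E.
Proof.
move=> mf fM fE.
have mfm : measurable_fun setT (fun w => f w - m).
  exact: measurable_funB.
have If := bounded_measurable_integrable mf fM.
have I1 : P.-integrable setT (EFin \o (fun w => (f w - m) ^+ 2)).
  apply: (@bounded_measurable_integrable _ ((M + `|m|) ^+ 2)).
    exact: measurable_funX.
  move=> w; rewrite normrX lerXn2r ?nnegrE//.
    by rewrite addr_ge0// (le_trans _ (fM w)).
  by rewrite (le_trans (ler_normB _ _))// lerD2r.
have I2 : P.-integrable setT (EFin \o (fun w => 2 * m * f w)).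
  exact: (integrableZl measurableT (2 * m) If).
have I3 : P.-integrable setT (EFin \o (fun w : T => - m ^+ 2)).
  by apply: (@bounded_measurable_integrable _ (`|- m ^+ 2|)).
have I23 : P.-integrable setT (EFin \o (fun w => 2 * m * f w + - m ^+ 2)).
  exact: (integrableD measurableT I2 I3).
transitivity (\int[P]_w (((f w - m) ^+ 2)%:E + (2 * m * f w + - m ^+ 2)%:E))%E.
  by apply: eq_integral => w _; rewrite -EFinD; congr EFin; ring.
rewrite (integralD_EFin measurableT I1 I23) addeC; congr (_ + _)%E.
transitivity (\int[P]_w ((2 * m * f w)%:E + (- m ^+ 2)%:E))%E => //.
rewrite (integralD_EFin measurableT I2 I3) /=.
under eq_integral do rewrite EFinM.
rewrite (integralZl measurableT If) fE (integral_cst _ measurableT).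
rewrite [X in (_ + _ * X)%E](probability_setT P) mule1.
by rewrite -EFinM -EFinD; congr EFin; ring.
Qed.

Variables (a : {RV P >-> R}) (z : R -> R).
Hypothesis zcont : continuous z.
Variable M : R.
Hypothesis zM : forall u, `|z u| <= M.
Hypothesis zE : forall u, (\int[P]_w (z (a w * u))%:E = (z u)%:E)%E.

Let g (u : R) : \bar R := (\int[P]_w ((z (a w * u) - z u) ^+ 2)%:E)%E.

Let mz : measurable_fun setT z.
Proof. exact: continuous_measurable_fun. Qed.

Let ma : measurable_fun setT a.
Proof. exact: measurable_funPT. Qed.

Let g_ge0 u : (0 <= g u)%E.
Proof. by apply: integral_ge0 => w _; rewrite lee_fin sqr_ge0. Qed.

(** The sample point [s] and the position [h] stay abstract so that one proof covers integrands on
    [T], [R * T] and [T * T]. *)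
Let measurable_incr (d' : measure_display) (S : measurableType d')
    (s : S -> T) (h : S -> R) :
  measurable_fun setT s -> measurable_fun setT h ->
  measurable_fun setT (fun x => ((z (a (s x) * h x) - z (h x)) ^+ 2)%:E).
Proof.
move=> ms mh; apply/measurable_EFinP/measurable_funX/measurable_funB.
  apply: (measurableT_comp mz); apply: measurable_funM => //.
  exact: (measurableT_comp ma).
exact: (measurableT_comp mz).
Qed.

Let measurable_g : measurable_fun setT g.
Proof.
exact: (measurable_fun_fubini_tonelli_F (m2 := P)
  (fun p : R * T => ((z (a p.2 * p.1) - z p.1) ^+ 2)%:E)
  (@measurable_incr _ _ snd fst measurable_snd measurable_fst)
  (fun p => sqr_ge0 _)).
Qed.

(* Commutativity of dilations lets Jensen's inequality be applied in the
   other variable. *)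
Let g_subharmonic u : (g u <= \int[P]_w g (a w * u))%E.
Proof.
have mp : measurable_fun setT
    (fun p : T * T => ((z (a p.2 * (a p.1 * u)) - z (a p.1 * u)) ^+ 2)%:E).
  apply: (measurable_incr (s := snd) (h := fun p => a p.1 * u)) => //.
  apply: measurable_funM => //.
  exact: (measurableT_comp ma).
rewrite (fubini_tonelli (m1 := P) (m2 := P) _ mp (fun p => sqr_ge0 _)) /=.
apply: ge0_le_integral => //.
- by move=> w _; exact: sqr_ge0.
- exact: (measurable_incr (s := id) (h := cst u)).
- exact: (measurable_fun_fubini_tonelli_G (m1 := P) _ mp (fun p => sqr_ge0 _)).
move=> w _.
have mzc v : measurable_fun setT (fun w' => z (a w' * v)).
  by apply: (measurableT_comp mz); apply: measurable_funM.
have Iz v : P.-integrable setT (EFin \o (fun w' => z (a w' * v))).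
  by apply: bounded_measurable_integrable => // w'; exact: zM.
(* After Tonelli the inner variable is the first step of the walk. Commuting the dilations makes the
   integrand the square of a function of mean [z (a w * u) - z u]; dropping its variance gives the
   bound. *)
under eq_integral do rewrite mulrCA.
rewrite (integral_sqr_mean (M := M + M) (m := z (a w * u) - z u)).
- by rewrite leeDl// integral_ge0// => w' _; rewrite lee_fin sqr_ge0.
- exact: measurable_funB.
- by move=> w'; rewrite (le_trans (ler_normB _ _))// lerD.
- by rewrite (integralB_EFin measurableT (Iz _) (Iz _)) /= !zE.
Qed.

(** Induction on [n]: one copy of [g u] turns [z u ^+ 2] into the mean of [z (a w * u) ^+ 2],
    subharmonicity moves the other [n] copies to [a w * u], and the induction hypothesis applies
    there pointwise. *)
Let sqr_add_g_bound n u : ((z u ^+ 2)%:E + n%:R%:E * g u <= (M ^+ 2)%:E)%E.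
Proof.
have zM2 v : z v ^+ 2 <= M ^+ 2.
  by rewrite -real_normK ?num_real// lerXn2r ?nnegrE// (le_trans _ (zM v)).
elim: n u => [|n IH] u; first by rewrite mul0e adde0 lee_fin.
have mau : measurable_fun setT (fun w => a w * u).
  exact: measurable_funM.
have mzu : measurable_fun setT (fun w => z (a w * u)).
  exact: (measurableT_comp mz).
have mzu2 : measurable_fun setT (fun w => ((z (a w * u)) ^+ 2)%:E).
  by apply/measurable_EFinP; exact: measurable_funX.
have mgu : measurable_fun setT (fun w => g (a w * u)).
  exact: (measurableT_comp measurable_g).
rewrite -natr1 EFinD ge0_muleDl ?lee_fin// mul1e addeCA addeC.
rewrite -(integral_sqr_mean mzu (fun w => zM _) (zE u)).
apply: (@le_trans _ _
    (\int[P]_w ((z (a w * u) ^+ 2)%:E + n%:R%:E * g (a w * u)))%E).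
  rewrite ge0_integralD//; last 3 first.
  - by move=> w _; rewrite lee_fin sqr_ge0.
  - by move=> w _; rewrite mule_ge0// lee_fin.
  - exact: measurable_funeM.
  by rewrite ge0_integralZl_EFin// leeD2l// lee_wpmul2l// lee_fin.
rewrite -[leRHS]mule1 -(probability_setT P) -integral_cst//.
apply: ge0_le_integral => //.
- by move=> w _; rewrite adde_ge0 ?mule_ge0 ?lee_fin ?sqr_ge0.
- by apply: emeasurable_funD => //; exact: measurable_funeM.
Qed.

Lemma harmonic_invariant : {ae P, forall w, forall u, z (a w * u) = z u}.
Proof.
have g0 u : g u = 0%E.
  have ng n : (n%:R%:E * g u <= (M ^+ 2)%:E)%E.
    by apply: le_trans (sqr_add_g_bound n u); rewrite leeDr// lee_fin sqr_ge0.
  (* A finite value [r > 0] fails the bound at the first integer above [M ^+ 2 / r]; the value [+oo]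
     fails it at [n = 1]. *)
  move: (g_ge0 u) ng; case: (g u) => [r| |//] /=.
  - rewrite lee_fin => r0 ng; congr EFin; apply/eqP/negPn/negP => rN0.
    have rgt0 : 0 < r by rewrite lt_neqAle eq_sym rN0.
    have := ng (Num.truncn (M ^+ 2 / r)).+1.
    rewrite -EFinM lee_fin -ler_pdivlMr// leNgt => /negP; apply.
    exact: truncnS_gt.
  - by move=> _ /(_ 1%N); rewrite mul1e leye_eq.
have ae_rat (q : rat) : {ae P, forall w, z (a w * ratr q) = z (ratr q)}.
  have mq := measurable_incr (s := id) (h := cst (ratr q))
    (@measurable_id _ _ setT) (measurable_cst _).
  have /(ae_eq_integral_abs P measurableT mq) :
      (\int[P]_w `|((z (a w * ratr q) - z (ratr q)) ^+ 2)%:E| = 0)%E.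
    by rewrite -[RHS](g0 (ratr q)); apply: eq_integral => w _;
      rewrite gee0_abs// lee_fin sqr_ge0.
  apply: filterS => w /(_ Logic.I) /= [] /eqP.
  by rewrite sqrf_eq0 subr_eq0 => /eqP.
(* Rationals are enumerated by their codes, so that countably many null sets are discarded at once;
   a code of no rational imposes nothing. *)
have : {ae P, forall w, forall n : nat,
   forall q : rat, unpickle n = Some q -> z (a w * ratr q) = z (ratr q)}.
  apply: ae_foralln => n.
  case: (unpickle n) => [q|]; last by apply: aeW.
  by apply: filterS (ae_rat q) => w wq _ [<-].
apply: filterS => w wq; apply: ratr_eq_continuous => //.
  move=> u; apply: continuous_comp; last exact: zcont.
  exact: mulrl_continuous.
by move=> q; exact: (wq (pickle q) q (pickleK q)).
Qed.

End harmonic.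

(** * Recentring at [c] and conclusion *)

Lemma measurable_neq_cst (d : measure_display) (T : measurableType d)
    (R : realType) (f : T -> R) (r : R) :
  measurable_fun setT f -> measurable [set w | f w != r].
Proof.
move=> mf; rewrite [X in measurable X](_ : _ = setT `&` f @^-1` ~` [set r]).
  exact: (mf measurableT _ (measurableC (measurable_set1 r))).
by rewrite setTI; apply/seteqP; split=> w /= /eqP.
Qed.

Theorem theorem2p4 (d : measure_display) (T : measurableType d) (R : realType)
    (P : probability T R) (alpha beta : {RV P >-> R})
    (alpha_neq0 : P [set w | alpha w != 0] = 1%E)
    (norm_alpha_neq1 : (0 < P [set w | (`|alpha w| != 1)%R])%E)
    (alpha_beta_resonance : resonance alpha beta)
    (y : R -> R)
    (y_bounded : bounded_fun y)
    (y_continuous : continuous y)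
    (y_eq : forall x : R,
      (y x)%:E = ('E_P[fun w => y (alpha w * (x - beta w))%R])%E) :
  exists k : R, forall x : R, y x = k.
Proof.
have [c res] := alpha_beta_resonance.
(* Resonance says that [c] is almost surely fixed by [x |-> alpha (x - beta)], which is thus a
   dilation about [c]. *)
pose z u := y (c + u).
(* Boundedness only provides bounds strictly above [M], hence [M + 1]. *)
have [M [_ /(_ (M + 1)) yM]] := y_bounded.
have zM u : `|z u| <= M + 1 by apply: yM => //; rewrite ltrDl.
have zcont : continuous z.
  move=> u; apply: continuous_comp; last exact: y_continuous.
  by apply: cvgD; [exact: cvg_cst|exact: cvg_id].
have my : measurable_fun setT y.
  exact: continuous_measurable_fun.
have malpha : measurable_fun setT alpha by exact: measurable_funPT.
have mbeta : measurable_fun setT beta by exact: measurable_funPT.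
have zE u : (\int[P]_w (z (alpha w * u))%:E = (z u)%:E)%E.
  rewrite {2}/z y_eq unlock; apply: ae_eq_integral => //.
  - apply/measurable_EFinP/(measurableT_comp my)/measurable_funD => //.
    exact: measurable_funM.
  - apply/measurable_EFinP/(measurableT_comp my)/measurable_funM => //.
    exact: measurable_funB.
  apply: filterS res => w wc _; congr (y _)%:E.
  by rewrite -[in LHS]wc; ring.
have inv := harmonic_invariant zcont zM zE.
have ae0 : {ae P, forall w, alpha w != 0}.
  have m0 : measurable [set w | alpha w != 0].
    exact: measurable_neq_cst.
  exists (~` [set w | alpha w != 0]); split => //; first exact: measurableC.
  by rewrite probability_setC// alpha_neq0 subee.
have [w [[wi w0] w1]] : exists w,
    ((forall u, z (alpha w * u) = z u) /\ alpha w != 0) /\ `|alpha w| != 1.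
  (* Without such a point, [|alpha| = 1] would hold off a null set, against [norm_alpha_neq1]. *)
  apply/not_existsP => none.
  have [N [mN N0 subN]] : {ae P, forall w, `|alpha w| == 1}.
    apply: filterS2 inv ae0 => w wi w0; apply/negPn/negP => w1.
    by apply: (none w).
  move: norm_alpha_neq1; rewrite ltNge => /negP; apply.
  rewrite -N0 le_measure// ?inE//; last first.
    by move=> w /= w1; apply: subN => /= /eqP; exact/eqP.
  apply: measurable_neq_cst.
  exact: (measurableT_comp (@normr_measurable R setT)).
exists (z 0) => x.
rewrite -(dilation_invariant_cst zcont w0 w1 wi (x - c)) /z.
by rewrite addrC subrK.
Qed.
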